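(* Let $u$ in $X\Omega_2u^\dagger$ and $u\Omega_2X^\dagger$ denote the all-ones row vector of length $\binom n2$, and set $u_2^\dagger=\Omega_2u^\dagger$, $\pi_2=u\Omega_2$. For any vector $X=(x_{ij})_{1\le i<j\le n}$ of length $\binom n2$, $$X\Omega_2u^\dagger=Xu_2^\dagger=\langle X,u_2\rangle=\tfrac12\operatorname{tr}\hat X\hat u_2=\tfrac12\operatorname{tr}\hat XN_0,$$ where $N_0=\langle J-KK^*\rangle$, the average being taken over the kernel $\mathcal K$; and $$u\Omega_2X^\dagger=\pi_2X^\dagger=\langle \pi_2,X\rangle=\tfrac12\operatorname{tr}\hat \pi_2\hat X=\tfrac12\operatorname{tr}\hat XM,$$ where $M=\langle K^*JK\rangle$, the average being taken over the kernel $\mathcal K$.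
   Context: Conventions: vectors are row vectors over $\mathbb Q$; $v^\dagger$ is the column vector corresponding to $v$; $Y^*$ is the transpose of a matrix $Y$; $J$ is the $n\times n$ all-ones matrix. Level two: a vector $X$ of length $\binom n2$ has components $x_{ij}$ indexed by pairs $i<j$ in $\{1,\dots,n\}$. $\hat X=\mathrm{Mat}(X)$ is the symmetric $n\times n$ matrix with zero diagonal and $\hat X_{ij}=\hat X_{ji}=x_{ij}$ for $i<j$. The inner product is $\langle X,X'\rangle=\frac12\operatorname{tr}\hat X\hat X'=\sum_{i<j}x_{ij}x'_{ij}$. For an $n\times n$ matrix $W$, $W^{\vee2}$ is the $\binom n2\times\binom n2$ matrix indexed by pairs with entries $(W^{\vee2})_{ab,cd}=W_{ac}W_{bd}+W_{ad}W_{bc}$ for $a<b$, $c<d$ (permanents of $2\times2$ submatrices). Setting: $A=\frac12(R+B)$, where $2A$ is the adjacency matrix of a 2-out-regular directed graph on $n$ vertices, strongly connected and aperiodic, and $R,B$ are $n\times n$ binary stochastic matrices (entries $0,1$, exactly one $1$ in each row). $\mathcal S$ is the finite semigroup generated by $R,B$ under multiplication and $\mathcal K$ is its kernel, i.e. its minimal two-sided ideal (the set of elements of minimal rank). $\mu^{(1)}$ is the probability measure on $\mathcal S$ giving mass $\frac12$ to each of $R$ and $B$ (mass $1$ if $R=B$), $\mu^{(m)}$ is its $m$-th convolution power, and $\lambda(w)=\lim_{M\to\infty}\frac1M\sum_{m=1}^M\mu^{(m)}(w)$; it is known that this limit exists and that $\lambda$ is a probability measure supported on $\mathcal K$. $\langle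 f(K)\rangle=\sum_{k\in\mathcal K}\lambda(k)f(k)$. With $A_2=\frac12(R^{\vee2}+B^{\vee2})$, $\Omega_2=\lim_{M\to\infty}\frac1M\sum_{m=1}^MA_2^{\,m}=\langle K^{\vee2}\rangle$. *)

(* Defs.v *)
From HB Require Import structures.
From mathcomp Require Import all_boot all_order all_algebra.
From mathcomp Require Import boolp classical_sets fsbigop.
From mathcomp Require Import topology normedtype sequences.

Set Implicit Arguments.
Unset Strict Implicit.
Unset Printing Implicit Defensive.

Import Order.TTheory GRing.Theory Num.Theory.
Import numFieldNormedType.Exports.

Local Open Scope classical_set_scope.
Local Open Scope ring_scope.

(* Limits are taken in rat^o because the normed topology is attached to the
   regular module of a concrete field.  The Cesaro limits used below exist in
   rat: they are entries of the projection onto ker (1 - P) along im (1 - P)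
   for a power-bounded rational matrix P. *)
Definition cesaro_lim (a : nat -> rat) : rat :=
  lim ((fun M : nat => M%:R^-1 * \sum_(1 <= m < M.+1) a m : rat^o) @ \oo).

Section Pairs.
Variable n : nat.

Definition pair_lt := {p : 'I_n * 'I_n | (p.1 < p.2)%N}.

Definition npairs : nat := #|{: pair_lt}|.

Lemma npairsE : npairs = 'C(n, 2).
Proof.
rewrite /npairs card_sig -sum1_card -(pair_big_dep predT
  (fun i j : 'I_n => (i < j)%N) (fun _ _ => 1%N)) /=.
rewrite (exchange_big_dep predT) //= -bin2_sum big_mkord.
apply: eq_bigr => j _; rewrite sum1_card -[RHS]card_ord.
have w_inj : injective (widen_ord (ltnW (ltn_ord j))).
  by move=> a b /(congr1 val) /= /val_inj.
rewrite -(card_imset _ w_inj); apply: eq_card => i.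
apply/idP/imsetP => [lt_ij | [k _ ->]]; last exact: (ltn_ord k).
by exists (Ordinal (lt_ij : (i < j)%N)) => //; apply: val_inj.
Qed.

Definition lo (p : 'I_npairs) : 'I_n := (val (enum_val p)).1.
Definition hi (p : 'I_npairs) : 'I_n := (val (enum_val p)).2.

(* The component x_ij for i < j (0 if i >= j). *)
Definition pcoord (X : 'rV[rat]_npairs) (i j : 'I_n) : rat :=
  if insub (i, j) is Some p then X 0 (enum_rank (p : pair_lt)) else 0.

Definition Mat (X : 'rV[rat]_npairs) : 'M[rat]_n :=
  \matrix_(i, j) if (i < j)%N then pcoord X i j
                 else if (j < i)%N then pcoord X j i else 0.

Definition inner2 (X Y : 'rV[rat]_npairs) : rat :=
  2^-1 * \tr (Mat X *m Mat Y).

Definition vee2 (W : 'M[rat]_n) : 'M[rat]_npairs :=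
  \matrix_(p, q) (W (lo p) (lo q) * W (hi p) (hi q)
                + W (lo p) (hi q) * W (hi p) (lo q)).

Definition ones2 : 'rV[rat]_npairs := const_mx 1.

Definition allones : 'M[rat]_n := const_mx 1.

End Pairs.

Section Digraphs.
Variable n : nat.

(* A directed graph on 'I_n, possibly with loops and multiple edges, is given
   by its adjacency matrix of edge multiplicities. *)
Definition edge (G : 'M[nat]_n) : rel 'I_n := [rel i j | (0 < G i j)%N].

Definition out_regular (d : nat) (G : 'M[nat]_n) : Prop :=
  forall i, (\sum_j G i j)%N = d.

Definition strongly_connected (G : 'M[nat]_n) : Prop :=
  forall i j, connect (edge G) i j.

(* The gcd of the lengths of the closed walks is 1; the empty sequence, which
   also satisfies [cycle], has length 0 and does not affect the gcd. *)
Definition aperiodic (G : 'M[nat]_n) : Prop :=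
  forall d : nat,
    (forall c : seq 'I_n, cycle (edge G) c -> (d %| size c)%N) -> d = 1%N.

End Digraphs.

Section Kernel.
Variable n : nat.

Definition binary_stochastic (W : 'M[rat]_n) : Prop :=
  (forall i j, W i j = 0 \/ W i j = 1) /\ (forall i, \sum_j W i j = 1).

Inductive semigroup (R B : 'M[rat]_n) : set 'M[rat]_n :=
| semigroup_R : semigroup R B R
| semigroup_B : semigroup R B B
| semigroup_mul s t :
    semigroup R B s -> semigroup R B t -> semigroup R B (s *m t).

Definition two_sided_ideal (S I : set 'M[rat]_n) : Prop :=
  [/\ I !=set0, I `<=` S &
      forall s k, S s -> I k -> I (s *m k) /\ I (k *m s)].

Definition is_kernel (S K : set 'M[rat]_n) : Prop :=
  two_sided_ideal S K /\
  forall I, two_sided_ideal S I -> I `<=` K -> I = K.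

End Kernel.

Section Measures.
Variables (n : nat) (R B : 'M[rat]_n).

Definition mu1 (w : 'M[rat]_n) : rat :=
  2^-1 * (w == R)%:R + 2^-1 * (w == B)%:R.

Definition conv (mu nu : 'M[rat]_n -> rat) (w : 'M[rat]_n) : rat :=
  \sum_(p \in [set p : 'M[rat]_n * 'M[rat]_n |
               [/\ semigroup R B p.1, semigroup R B p.2 & p.1 *m p.2 = w]])
    mu p.1 * nu p.2.

(* The m-th convolution power of mu1, meaningful for m >= 1. *)
Definition mu_pow (m : nat) : 'M[rat]_n -> rat := iter m.-1 (conv mu1) mu1.

Definition lambda (w : 'M[rat]_n) : rat := cesaro_lim (fun m => mu_pow m w).

Definition kernel_average (K : set 'M[rat]_n)
    (f : 'M[rat]_n -> 'M[rat]_n) : 'M[rat]_n :=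
  \sum_(k \in K) lambda k *: f k.

Definition A2 : 'M[rat]_(npairs n) := 2^-1 *: (vee2 R + vee2 B).

Definition Omega2 : 'M[rat]_(npairs n) :=
  \matrix_(p, q) cesaro_lim (fun m => (A2 ^+ m) p q).

Definition u2 : 'rV[rat]_(npairs n) := (Omega2 *m (ones2 n)^T)^T.

Definition pi2 : 'rV[rat]_(npairs n) := ones2 n *m Omega2.

Definition N0 (K : set 'M[rat]_n) : 'M[rat]_n :=
  kernel_average K (fun k => allones n - k *m k^T).

Definition Mavg (K : set 'M[rat]_n) : 'M[rat]_n :=
  kernel_average K (fun k => k^T *m allones n *m k).

End Measures.

(* Main.v *)
Require Import Defs.
From mathcomp Require Import all_boot all_order all_algebra.
From mathcomp Require Import boolp classical_sets fsbigop.
From mathcomp Require Import topology normedtype sequences.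
From mathcomp Require Import ring lra.

(** Averages over the kernel come from a finite Markov chain.  A binary
    stochastic matrix is the matrix of a self-map of the index set, and left
    multiplication by [R] or [B], each with probability 1/2, is a Markov chain
    on the finite set of these matrices; started at the identity, its law at
    time [m > 0] is the convolution power [mu_pow m] ([mu_powE]).  The mean ergodic
    theorem for power-bounded matrices ([mean_ergodic]) then gives that the
    limit [lambda] exists in the rationals and is an invariant measure of the
    chain ([lambda_cesaro]).

    The measure [lambda] does not charge the complement of an ideal [K]
    ([lambda_support]).  A step of the chain never leaves [K], so by invariance
    no mass enters it either.  Hence the charged points outside [K] are stable
    under left multiplication by [R] and [B], and so by the whole semigroup,
    whereas multiplication by an element of [K] sends every element of the
    semigroup into [K].

    On matrices of self-maps, [vee2] is multiplicative on the right
    ([vee2_mul]): the Cauchy-Binet expansion of a product of permanents has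
    extra terms with a repeated intermediate index, and these vanish because a
    row of the right factor has a single nonzero entry.
    Thus [A2 ^+ m] is the average of [vee2] under the law of the chain at time
    [m], and [Omega2] is the average of [vee2] under [lambda] ([Omega2E]).

    It remains to sum one matrix [vee2 k] along rows and columns.  The row
    indexed by a < b sums to the sum of [k a c * k b d] over all [c != d],
    which is 1 minus the diagonal part, that is an entry of [J - k k^T]
    ([vee2_row_sum]); a column likewise gives an entry of [k^T J k], whose
    diagonal part vanishes ([vee2_col_sum]).  So [N0] and [Mavg] agree with
    [Mat u2] and [Mat pi2] off the diagonal, and the diagonal is invisible in a
    trace against the zero-diagonal matrix [Mat X] ([trace_Mat]). *)

Set Implicit Arguments.
Unset Strict Implicit.
Unset Printing Implicit Defensive.

Import Order.TTheory GRing.Theory Num.Theory.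
Import numFieldNormedType.Exports.
Local Open Scope ring_scope.

(** * Cesaro means of bounded error *)

Lemma bounded_multiples_le0 (x C : rat) :
  (forall M : nat, M%:R * x <= C) -> x <= 0.
Proof.
move=> h; rewrite leNgt; apply/negP => x0.
by have := h (Num.truncn (C / x)).+1; rewrite leNgt -ltr_pdivrMr // truncnS_gt.
Qed.

(** Cesaro convergence with error O(1/M), cleared of denominators.  Unlike bare
    convergence it is stable under finite sums and order by plain estimates in
    the rationals, and every average below converges at this rate. *)
Definition cesaro_fast (a : nat -> rat) (l : rat) : Prop :=
  exists C : rat, forall M : nat,
    `|\sum_(1 <= m < M.+1) a m - M%:R * l| <= C.

Lemma cesaro_fast_lim a l : cesaro_fast a l -> cesaro_lim a = l.
Proof.
case=> C hC; have C0 : 0 <= C by exact: le_trans (normr_ge0 _) (hC 0).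
apply: (@cvg_lim rat^o); first exact: norm_hausdorff.
apply/cvgrPdist_le => e e0.
exists (Num.truncn (C / e)).+1 => // M /= leM.
have M0 : 0 < M%:R :> rat by rewrite ltr0n; apply: leq_trans leM.
rewrite distrC -[X in _ - X](mulKf (lt0r_neq0 M0)) -mulrBr normrM normfV.
rewrite (gtr0_norm M0) mulrC ler_pdivrMr //; apply: le_trans (hC M) _.
rewrite mulrC -ler_pdivrMr //; apply/ltW/(lt_le_trans (truncnS_gt _)).
by rewrite ler_nat.
Qed.

Lemma cesaro_fast_sum (I : finType) (c l : I -> rat) (a : I -> nat -> rat) :
  (forall i, cesaro_fast (a i) (l i)) ->
  cesaro_fast (fun m => \sum_i a i m * c i) (\sum_i l i * c i).
Proof.
move=> /choice [C hC]; exists (\sum_i C i * `|c i|) => M.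
rewrite exchange_big mulr_sumr -sumrB.
apply: le_trans (ler_norm_sum _ _ _) _; apply: ler_sum => i _.
rewrite -mulr_suml mulrA -mulrBl normrM.
by apply: ler_wpM2r.
Qed.

Lemma eq_cesaro_fast (a b : nat -> rat) l :
  (forall m, (0 < m)%N -> a m = b m) -> cesaro_fast a l -> cesaro_fast b l.
Proof.
move=> eq_ab [C hC]; exists C => M; rewrite (eq_big_nat _ _ (F2 := a)) //.
by move=> m /andP[m0 _]; rewrite eq_ab.
Qed.

Lemma cesaro_fast_ge0 (a : nat -> rat) l :
  (forall m, (0 < m)%N -> 0 <= a m) -> cesaro_fast a l -> 0 <= l.
Proof.
move=> a0 [C hC]; rewrite -oppr_le0; apply: (@bounded_multiples_le0 _ C) => M.
have /ler_normlP[_] := hC M; apply: le_trans.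
by rewrite mulrN lerDr big_nat sumr_ge0 // => m /andP[m0 _]; apply: a0.
Qed.

(** * The mean ergodic theorem *)

(** Let [D := 1 - P].  A row vector that lies in the image of [D] and is fixed by
    [P] has the form [u = w D], so that [w P^m = w - m u]; boundedness forces
    [u = 0].  Thus [D] and [D^2] have the same rank, which provides [Z] with
    [D = Z D^2].  Then [l := v - v Z D] is fixed by [P], and the remainder
    [v Z D P^m] telescopes when summed over [m]. *)
Lemma mean_ergodic N (P : 'M[rat]_N) (C : rat) (v : 'rV[rat]_N) :
  (forall m i j, `|(P ^+ m) i j| <= C) ->
  exists l : 'rV[rat]_N, l *m P = l /\
    forall j, cesaro_fast (fun m => (v *m P ^+ m) 0 j) (l 0 j).
Proof.
move=> P_bdd.
have orbit_bdd (w : 'rV[rat]_N) m j :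
    `|(w *m P ^+ m) 0 j| <= \sum_i `|w 0 i| * C.
  rewrite mxE; apply: le_trans (ler_norm_sum _ _ _) _; apply: ler_sum => i _.
  by rewrite normrM ler_wpM2l.
pose D : 'M_N := 1%:M - P.
have cap0 : (D :&: kermx D)%MS = 0.
  apply/eqP; rewrite -submx0; apply/rV_subP => u.
  rewrite sub_capmx => /andP[/submxP[w uE] /sub_kermxP uD].
  have uP : u *m P = u.
    by apply/esym/eqP; rewrite -subr_eq0 -{1}[u]mulmx1 -mulmxBr uD.
  have wPm m : w *m P ^+ m = w - m%:R *: u.
    elim: m => [|m IHm]; first by rewrite expr0 mulmx1 scale0r subr0.
    rewrite exprSr [_ * P]/(_ *m P) mulmxA IHm mulmxBl -scalemxAl uP.
    have -> : w *m P = w - u by rewrite uE mulmxBr mulmx1 subKr.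
    by rewrite -[m.+1]addn1 natrD scalerDl scale1r opprD addrA addrAC.
  (* The sign [e] treats the two inequalities giving [u = 0] at once. *)
  have ule0 (e : rat) j : (e == 1) || (e == -1) -> e * u 0 j <= 0.
    move=> e1; have en : `|e| = 1 by case/orP: e1 => /eqP->;
      rewrite ?normrN1 ?normr1.
    apply: (@bounded_multiples_le0 _ (`|w 0 j| + \sum_i `|w 0 i| * C)) => m.
    apply: le_trans (ler_norm _) _; rewrite mulrCA normrM en mul1r.
    have := wPm m => /rowP/(_ j); rewrite [in RHS]mxE [in RHS]mxE [in RHS]mxE => wj.
    have -> : m%:R * u 0 j = w 0 j - (w *m P ^+ m) 0 j by rewrite wj; ring.
    apply: le_trans (ler_normB _ _) _; exact: lerD.
  have -> : u = 0.
    apply/rowP => j; rewrite mxE; apply/eqP; rewrite eq_le.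
    have := ule0 1 j isT; have := ule0 (-1) j isT; lra.
  exact: sub0mx.
have : (D <= D *m D)%MS.
  rewrite -(geq_leqif (mxrank_leqif_sup (submxMl D D))).
  by rewrite -[X in (X <= _)%N](mxrank_mul_ker D D) cap0 mxrank0 addn0.
case/submxP => Z DE.
pose l := v - v *m Z *m D.
have lP : l *m P = l.
  apply/esym/eqP; rewrite -subr_eq0 -{1}[l]mulmx1 -mulmxBr -/D /l mulmxBl.
  by rewrite -!mulmxA -DE subrr.
have lPm m : l *m P ^+ m = l.
  elim: m => [|m IHm]; first by rewrite expr0 mulmx1.
  by rewrite exprSr [_ * P]/(_ *m P) mulmxA IHm.
have vE m : v *m P ^+ m = l + (v *m Z *m P ^+ m - v *m Z *m P ^+ m.+1).
  have {1}-> : v = l + v *m Z *m D by rewrite subrK.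
  rewrite mulmxDl lPm; congr (_ + _).
  by rewrite exprS [P * _]/(P *m _) -mulmxBr -!mulmxA mulmxBl mul1mx.
exists l; split=> // j; set w := v *m Z; pose c := \sum_i `|w 0 i| * C.
exists (c + c) => M.
rewrite (eq_bigr (fun m => l 0 j - ((w *m P ^+ m.+1) 0 j - (w *m P ^+ m) 0 j)));
  last by move=> m _; rewrite vE !mxE -/w opprB.
rewrite sumrB telescope_sumr // sumr_const_nat subn1 /= -[_ *+ M]mulr_natl.
rewrite addrAC subrr add0r normrN.
apply: le_trans (ler_normB _ _) _; apply: lerD; exact: orbit_bdd.
Qed.

(** * Sums over pairs and the matrix of a vector of pairs *)

Lemma lo_lt_hi n (p : 'I_(npairs n)) : (lo p < hi p)%N.
Proof. exact: (valP (enum_val p)). Qed.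

Lemma lo_neq_hi n (p : 'I_(npairs n)) : lo p != hi p.
Proof. by rewrite -(inj_eq val_inj) /= ltn_eqF // lo_lt_hi. Qed.

Lemma lo_hi_inj n (p q : 'I_(npairs n)) : lo p = lo q -> hi p = hi q -> p = q.
Proof.
move=> l h; apply: enum_val_inj; apply: val_inj.
by rewrite [LHS]surjective_pairing [RHS]surjective_pairing; congr pair.
Qed.

Lemma sum_lt_pairs n (h : 'I_n -> 'I_n -> rat) :
  \sum_(i < n) \sum_(j < n | (i < j)%N) h i j = \sum_(p < npairs n) h (lo p) (hi p).
Proof.
rewrite (pair_big_dep predT (fun i j : 'I_n => (i < j)%N)) /=.
rewrite [RHS](reindex (@enum_rank (pair_lt n))) /=; last first.
  by apply: onW_bij; exact: enum_rank_bij.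
rewrite (reindex_omap (val : pair_lt n -> _) insub) /=; last first.
  by move=> p lt_p; rewrite insubT.
apply: eq_big => [p|p _]; last by rewrite /lo /hi enum_rankK.
by rewrite (valP p) valK eqxx.
Qed.

(** Splits a double sum into its diagonal and the pairs taken in both orders;
    this is how products of full rows of entries become entries of [vee2]. *)
Lemma sum_all_pairs n (h : 'I_n -> 'I_n -> rat) :
  \sum_i \sum_j h i j =
  \sum_i h i i + \sum_(p < npairs n) (h (lo p) (hi p) + h (hi p) (lo p)).
Proof.
rewrite big_split /= -(sum_lt_pairs h) -(sum_lt_pairs (fun i j => h j i)).
rewrite [X in _ = _ + (_ + X)](exchange_big_dep predT) //= -!big_split /=.
apply: eq_bigr => i _; rewrite (bigD1 i) //=; congr (_ + _).
rewrite (bigID (fun j : 'I_n => (i < j)%N)) /=.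
congr (_ + _); apply: eq_bigl => j.
  by rewrite -(inj_eq val_inj) /=; case: ltngtP.
by rewrite -(inj_eq val_inj) /=; case: ltngtP.
Qed.

Lemma Mat_lo_hi n (X : 'rV[rat]_(npairs n)) p : Mat X (lo p) (hi p) = X 0 p.
Proof.
rewrite mxE lo_lt_hi /pcoord insubT ?lo_lt_hi // => lt_p.
rewrite (_ : Sub _ _ = enum_val p) ?enum_valK //.
by apply: val_inj; rewrite SubK -surjective_pairing.
Qed.

Lemma Mat_sym n (X : 'rV[rat]_(npairs n)) i j : Mat X i j = Mat X j i.
Proof. by rewrite !mxE; case: ltngtP. Qed.

(** Both matrices are symmetric and the diagonal of [Mat X] is zero, so each pair
    is counted twice and the diagonal of [M] does not enter. *)
Lemma trace_Mat n (X : 'rV[rat]_(npairs n)) (M : 'M[rat]_n) :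
  (forall i j, M i j = M j i) ->
  2^-1 * \tr (Mat X *m M) = \sum_p X 0 p * M (lo p) (hi p).
Proof.
move=> M_sym; rewrite /mxtrace.
under eq_bigr do rewrite mxE.
rewrite sum_all_pairs big1 => [|i _]; last by rewrite mxE ltnn mul0r.
rewrite add0r mulr_sumr; apply: eq_bigr => p _.
rewrite (Mat_sym _ (hi p)) (M_sym (hi p)) Mat_lo_hi; lra.
Qed.

Lemma inner2E n (X Y : 'rV[rat]_(npairs n)) : inner2 X Y = (X *m Y^T) 0 0.
Proof.
rewrite /inner2 trace_Mat; last exact: Mat_sym.
by rewrite [RHS]mxE; apply: eq_bigr => p _; rewrite Mat_lo_hi mxE.
Qed.

(** * Matrices of self-maps *)

Definition funmx n (f : {ffun 'I_n -> 'I_n}) : 'M[rat]_n :=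
  \matrix_(i, j) (f i == j)%:R.

(** Each row has nonnegative entries of sum 1 with values 0 and 1, hence exactly
    one entry 1; its column is the value of the self-map. *)
Lemma funmxP n (W : 'M[rat]_n) :
  binary_stochastic W -> exists f, W = funmx f.
Proof.
case=> W01 W1; have W0 i j : 0 <= W i j by case: (W01 i j) => ->.
have /fin_all_exists [f fP] i : exists j, W i j = 1.
  apply: contrapT => nW; have := W1 i.
  rewrite big1 => [/eqP|j _]; first by rewrite eq_sym oner_eq0.
  by case: (W01 i j) => // Wij; case: nW; exists j.
exists (finfun f); apply/matrixP => i j; rewrite mxE ffunE.
have [<-|ne] := eqVneq; first exact: fP.
have := W1 i; rewrite (bigD1 (f i)) //= fP -[RHS]addr0 => /addrI/eqP.
by rewrite psumr_eq0 // => /allP/(_ j)/[!mem_index_enum]/(_ isT)/implyP/(_ _)/eqP->;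
  rewrite // eq_sym.
Qed.

Lemma funmx_inj n : injective (@funmx n).
Proof.
move=> f g /matrixP fg; apply/ffunP => i; have := fg i (g i).
by rewrite !mxE eqxx; case: eqP => // _ /eqP; rewrite eq_sym oner_eq0.
Qed.

Lemma sum_funmx n (f : {ffun 'I_n -> 'I_n}) i (h : 'I_n -> rat) :
  \sum_j funmx f i j * h j = h (f i).
Proof.
rewrite (bigD1 (f i)) //= mxE eqxx mul1r big1 ?addr0 // => j ne.
by rewrite mxE eq_sym (negPf ne) mul0r.
Qed.

Lemma mul_funmx n (f g : {ffun 'I_n -> 'I_n}) :
  funmx f *m funmx g = funmx [ffun i => g (f i)].
Proof. by apply/matrixP => i j; rewrite mxE sum_funmx !mxE ffunE. Qed.

Lemma funmx1 n : funmx [ffun i : 'I_n => i] = 1%:M.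
Proof. by apply/matrixP => i j; rewrite !mxE ffunE. Qed.

Lemma funmx_row1 n (f : {ffun 'I_n -> 'I_n}) i : \sum_j funmx f i j = 1.
Proof.
rewrite -[RHS](sum_funmx f i (fun=> 1)).
by under [RHS]eq_bigr do rewrite mulr1.
Qed.

(** A row has a single nonzero entry. *)
Lemma funmx_col_disjoint n (f : {ffun 'I_n -> 'I_n}) i j k :
  j != k -> funmx f i j * funmx f i k = 0.
Proof.
by move=> ne; rewrite !mxE; have [->|] := eqVneq; rewrite ?mul0r // (negPf ne) mulr0.
Qed.

(** * Second symmetric powers of matrices of self-maps *)

(** The product on the left sums over pairs of distinct intermediate indices, the
    right-hand side over all pairs of them; the diagonal terms contain a product
    of two entries of [funmx f] in one row and in the distinct columns [lo q]
    and [hi q]. *)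
Lemma vee2_mul n (W : 'M[rat]_n) (f : {ffun 'I_n -> 'I_n}) :
  vee2 W *m vee2 (funmx f) = vee2 (W *m funmx f).
Proof.
apply/matrixP => p q; rewrite !mxE.
pose h i j := W (lo p) i * W (hi p) j *
  (funmx f i (lo q) * funmx f j (hi q) + funmx f i (hi q) * funmx f j (lo q)).
transitivity (\sum_i \sum_j h i j); last first.
  rewrite !mulr_suml -big_split; apply: eq_bigr => i _ /=.
  rewrite !mulr_sumr -big_split; apply: eq_bigr => j _ /=.
  by rewrite /h; ring.
rewrite sum_all_pairs [X in _ = X + _]big1 => [|i _]; last first.
  by rewrite /h !funmx_col_disjoint ?addr0 ?mulr0 // ?[hi q == _]eq_sym lo_neq_hi.
rewrite add0r; apply: eq_bigr => e _; rewrite /h !mxE; ring.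
Qed.

Lemma vee2_1 n : vee2 1%:M = 1%:M :> 'M_(npairs n).
Proof.
apply/matrixP => p q; rewrite !mxE.
have [<-|ne] := eqVneq p q.
  by rewrite !eqxx mul1r (negPf (lo_neq_hi p)) mul0r addr0.
have -> : (lo p == hi q)%:R * (hi p == lo q)%:R = 0 :> rat.
  case: eqP => [lp|]; last by rewrite mul0r.
  case: eqP => [hp|]; last by rewrite mulr0.
  by have := ltn_trans (lo_lt_hi p) (_ : hi p < hi q)%N;
     rewrite lp hp lo_lt_hi ltnn => /(_ isT).
rewrite addr0; case: eqP => [lp|]; last by rewrite mul0r.
case: eqP => [hp|]; last by rewrite mulr0.
by case/eqP: ne; apply: lo_hi_inj.
Qed.

(** The sum of all products [f a c * f b d] is 1, and the diagonal part [c = d]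
    that is missing from the left-hand side is an entry of [f f^T]. *)
Lemma vee2_row_sum n (f : {ffun 'I_n -> 'I_n}) p :
  \sum_q vee2 (funmx f) p q = (allones n - funmx f *m (funmx f)^T) (lo p) (hi p).
Proof.
have := sum_all_pairs (fun i j => funmx f (lo p) i * funmx f (hi p) j).
under eq_bigr do rewrite -mulr_sumr funmx_row1 mulr1.
rewrite funmx_row1 => eq1; rewrite 3!mxE eq1 [in X in _ - X]mxE.
under [X in _ - X]eq_bigr do rewrite [_^T _ _]mxE.
by rewrite addrAC subrr add0r; apply: eq_bigr => q _; rewrite mxE.
Qed.

(** Here the diagonal part of the double sum vanishes since [lo q] and [hi q] are
    distinct columns. *)
Lemma vee2_col_sum n (f : {ffun 'I_n -> 'I_n}) q :
  \sum_p vee2 (funmx f) p q = ((funmx f)^T *m allones n *m funmx f) (lo q) (hi q).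
Proof.
have := sum_all_pairs (fun i j => funmx f i (lo q) * funmx f j (hi q)).
rewrite [X in _ = X + _]big1 => [|i _]; last first.
  by rewrite funmx_col_disjoint // lo_neq_hi.
rewrite add0r => eq1.
transitivity (\sum_i \sum_j funmx f i (lo q) * funmx f j (hi q)).
  by rewrite eq1; apply: eq_bigr => p _; rewrite mxE; congr (_ + _); rewrite mulrC.
rewrite mxE exchange_big; apply: eq_bigr => j _.
rewrite -mulr_suml; congr (_ * _); rewrite mxE; apply: eq_bigr => i _.
by rewrite [_^T _ _]mxE [allones _ _ _]mxE mulr1.
Qed.

(** * The random walk on matrices of self-maps *)

Definition nfun n : nat := #|{ffun 'I_n -> 'I_n}|.

(** An enumeration by ordinals, so that measures on these matrices are row
    vectors and the transition operator is a square matrix. *)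
Definition fmat n (i : 'I_(nfun n)) : 'M[rat]_n := funmx (enum_val i).

Definition is_funmx n (w : 'M[rat]_n) : Prop := exists i, w = fmat i.

Lemma is_funmx_bs n (w : 'M[rat]_n) : binary_stochastic w -> is_funmx w.
Proof.
by case/funmxP => f ->; exists (enum_rank f); rewrite /fmat enum_rankK.
Qed.

Lemma is_funmx_mul n (v w : 'M[rat]_n) : is_funmx v -> is_funmx w -> is_funmx (v *m w).
Proof.
case=> [i ->] [j ->]; rewrite /fmat mul_funmx.
by eexists (enum_rank _); rewrite /fmat enum_rankK.
Qed.

Lemma is_funmx1 n : is_funmx (1%:M : 'M[rat]_n).
Proof.
by exists (enum_rank [ffun i => i]); rewrite /fmat enum_rankK funmx1.
Qed.

Lemma fmat_inj n : injective (@fmat n).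
Proof. by move=> i j /funmx_inj /enum_val_inj. Qed.

Lemma sum_fmat_eq n (w : 'M[rat]_n) (g : 'M[rat]_n -> rat) :
  is_funmx w -> \sum_j (w == fmat j)%:R * g (fmat j) = g w.
Proof.
case=> i ->; rewrite (bigD1 i) //= eqxx mul1r big1 ?addr0 // => j ne.
by rewrite (inj_eq (@fmat_inj n)) eq_sym (negPf ne) mul0r.
Qed.

Lemma semigroup_is_funmx n (R B w : 'M[rat]_n) :
  is_funmx R -> is_funmx B -> semigroup R B w -> is_funmx w.
Proof. by move=> fR fB; elim=> // s t _ fs _; apply: is_funmx_mul. Qed.

Lemma fsbig_funmx n (V : zmodType) (A : set 'M[rat]_n) (F : 'M[rat]_n -> V) :
  (forall w, A w -> is_funmx w) ->
  \sum_(w \in A) F w = \sum_(i | `[< A (fmat i) >]) F (fmat i).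
Proof.
move=> A_funmx.
pose r := [seq fmat i | i <- enum 'I_(nfun n) & `[< A (fmat i) >]].
rewrite (fsbigE r); first 1 last.
- by rewrite (map_inj_uniq (@fmat_inj n)) filter_uniq ?enum_uniq.
- by move=> w /= /mapP[i]; rewrite mem_filter => /andP[/asboolP Ai _] ->.
- move=> w Aw /mapP []; have [i wE] := A_funmx w Aw.
  by exists i => //; rewrite mem_filter mem_enum andbT -wE; apply/asboolP.
rewrite big_map big_filter_cond big_enum_cond /=; apply: eq_bigl => i.
by rewrite andb_idr // => /asboolP Ai; apply: mem_set.
Qed.

Definition transition n (R B : 'M[rat]_n) : 'M[rat]_(nfun n) :=
  \matrix_(i, j) (2^-1 * (R *m fmat i == fmat j)%:R
                   + 2^-1 * (B *m fmat i == fmat j)%:R).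

Section Chain.
Variables (n : nat) (R B : 'M[rat]_n).
Hypotheses (R_funmx : is_funmx R) (B_funmx : is_funmx B).
Let P := transition R B.

(** The expected value of [g] after one step from a given state. *)
Lemma transition_sum i (g : 'M[rat]_n -> rat) :
  \sum_j P i j * g (fmat j) = 2^-1 * g (R *m fmat i) + 2^-1 * g (B *m fmat i).
Proof.
have fRi : is_funmx (R *m fmat i) by apply: is_funmx_mul => //; exists i.
have fBi : is_funmx (B *m fmat i) by apply: is_funmx_mul => //; exists i.
rewrite -[in RHS](sum_fmat_eq _ fRi) -[in RHS](sum_fmat_eq _ fBi) !mulr_sumr.
by rewrite -big_split; apply: eq_bigr => j _; rewrite mxE /=; ring.
Qed.

Lemma row_transition_sum (u : 'rV[rat]_(nfun n)) (g : 'M[rat]_n -> rat) :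
  \sum_j (u *m P) 0 j * g (fmat j) =
  \sum_i u 0 i * (2^-1 * g (R *m fmat i) + 2^-1 * g (B *m fmat i)).
Proof.
under eq_bigr do rewrite mxE mulr_suml.
rewrite exchange_big; apply: eq_bigr => i _ /=.
by rewrite -transition_sum mulr_sumr; apply: eq_bigr => j _; rewrite mulrA.
Qed.

Lemma transition_pow_ge0 m i j : 0 <= (P ^+ m) i j.
Proof.
elim: m i j => [|m IHm] i j; first by rewrite expr0 mxE ler0n.
rewrite exprS mxE sumr_ge0 // => k _; rewrite mulr_ge0 // mxE.
by rewrite addr_ge0 // mulr_ge0 // ler0n.
Qed.

Lemma transition_pow_row1 m i : \sum_j (P ^+ m) i j = 1.
Proof.
elim: m i => [|m IHm] i.
  rewrite expr0 (bigD1 i) //= mxE eqxx big1 ?addr0 // => j ne.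
  by rewrite mxE eq_sym (negPf ne).
rewrite exprS; under eq_bigr do rewrite mxE.
rewrite exchange_big /=; under eq_bigr do rewrite -mulr_sumr IHm.
by rewrite (transition_sum i (fun=> 1)); lra.
Qed.

Lemma transition_pow_bounded m i j : `|(P ^+ m) i j| <= 1.
Proof.
rewrite ger0_norm ?transition_pow_ge0 // -(transition_pow_row1 m i).
rewrite (bigD1 j) //= lerDl sumr_ge0 // => k _; exact: transition_pow_ge0.
Qed.

(** The point mass at the identity matrix, which need not belong to the
    semigroup; one step from it has law [mu1]. *)
Definition start : 'rV[rat]_(nfun n) := \row_i (1%:M == fmat i)%:R.

Lemma sum_start (g : 'M[rat]_n -> rat) : \sum_i start 0 i * g (fmat i) = g 1%:M.
Proof.
under eq_bigr do rewrite mxE.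
by apply: sum_fmat_eq; apply: is_funmx1.
Qed.

Lemma mu_pow_out m w : ~ semigroup R B w -> mu_pow R B m w = 0.
Proof.
rewrite /mu_pow; elim: m.-1 => [|k _] nw /=.
  rewrite /mu1; have [wR|_] := eqVneq w R.
    by case: nw; rewrite wR; apply: semigroup_R.
  have [wB|_] := eqVneq w B; first by case: nw; rewrite wB; apply: semigroup_B.
  by rewrite !mulr0 addr0.
rewrite /conv (_ : (fun _ => _) = set0) ?fsbig_set0 //.
apply/seteqP; split=> // -[s t] /= [Ss St wE]; case: nw.
by rewrite -wE; apply: semigroup_mul.
Qed.

(** Removing duplicates accounts for the case [R = B], where [mu1] has mass 1 at
    a single point. *)
Lemma sum_mu1 (g : 'M[rat]_n -> rat) :
  \sum_(x <- undup [:: R; B]) mu1 R B x * g x = 2^-1 * g R + 2^-1 * g B.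
Proof.
rewrite /undup inE; case: eqVneq => [->|ne].
  by rewrite big_seq1 /mu1 eqxx /=; ring.
rewrite !big_cons big_nil /mu1 !eqxx (negPf ne) eq_sym (negPf ne) /=; ring.
Qed.

(** Convolution by [mu1] on the left is one step of the chain, provided that the
    measure lives on the semigroup, over which [conv] sums. *)
Lemma conv_mu1 (nu : 'M[rat]_n -> rat) w :
  (forall t, ~ semigroup R B t -> nu t = 0) ->
  conv R B (mu1 R B) nu w =
  \sum_i nu (fmat i) *
    (2^-1 * (R *m fmat i == w)%:R + 2^-1 * (B *m fmat i == w)%:R).
Proof.
move=> nu_out; rewrite /conv; set A := [set p | _]%classic.
pose cands := [seq (x, y) | x <- undup [:: R; B],
                            y <- map (@fmat n) (enum 'I_(nfun n))].
(* Only the pairs whose first factor is [R] or [B] carry mass. *)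
rewrite (fsbigE [seq p <- cands | p \in A]); first 1 last.
- rewrite filter_uniq // allpairs_uniq ?undup_uniq //; last by move=> [? ?] [? ?].
  by rewrite (map_inj_uniq (@fmat_inj n)) enum_uniq.
- by move=> p /=; rewrite mem_filter => /andP[/set_mem].
- move=> [s t] Ast; rewrite mem_filter mem_set //= => /negP nst.
  have [Ss St _] := Ast.
  have [i tE] := semigroup_is_funmx R_funmx B_funmx St.
  have : s \notin undup [:: R; B].
    apply/negP => sin; apply: nst; apply/allpairsP; exists (s, t); split=> //=.
    by move: tE => /= ->; rewrite map_f ?mem_enum.
  rewrite mem_undup !inE negb_or /mu1 => /andP[/negPf-> /negPf->].
  by rewrite !mulr0 addr0 mul0r.
rewrite big_filter_cond big_mkcond big_allpairs.
pose g x := \sum_i nu (fmat i) * (x *m fmat i == w)%:R.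
rewrite (eq_big_seq (fun x => mu1 R B x * g x)).
  rewrite sum_mu1 !mulr_sumr -big_split /=.
  by apply: eq_bigr => i _; ring.
move=> x; rewrite mem_undup => xRB; rewrite big_map big_enum mulr_sumr /=.
apply: eq_bigr => i _; rewrite andbb mulrCA.
have Sx : semigroup R B x.
  by move: xRB; rewrite !inE => /orP[] /eqP->; [apply: semigroup_R | apply: semigroup_B].
have [Si|nSi] := pselect (semigroup R B (fmat i)); last first.
  by rewrite nu_out // !mul0r mulr0 if_same.
case: ifPn => [/set_mem[_ _ /= /eqP->]|]; first by rewrite mulr1 mulrC.
by case: eqP => [wE /negP[]|]; [apply: mem_set | rewrite !mulr0].
Qed.

Lemma mu_powE m i : (0 < m)%N -> mu_pow R B m (fmat i) = (start *m P ^+ m) 0 i.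
Proof.
case: m => // m _; elim: m i => [|m IHm] i; last first.
  rewrite exprSr [_ * P]/(_ *m P) mulmxA mxE [LHS]conv_mu1;
    last exact: mu_pow_out m.+1.
  by apply: eq_bigr => j _; rewrite -IHm [P j i]mxE.
rewrite expr1 /mu_pow /= /mu1 mxE.
pose g w : rat := 2^-1 * (R *m w == fmat i)%:R + 2^-1 * (B *m w == fmat i)%:R.
transitivity (g 1%:M); first by rewrite /g !mulmx1 ![fmat i == _]eq_sym.
by rewrite -sum_start; apply: eq_bigr => j _; rewrite [P j i]mxE.
Qed.

(** * The invariant measure and its support *)

Let lambda_row : 'rV[rat]_(nfun n) := \row_i lambda R B (fmat i).

Lemma lambda_cesaro :
  lambda_row *m P = lambda_row /\
  forall i, cesaro_fast (fun m => (start *m P ^+ m) 0 i) (lambda R B (fmat i)).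
Proof.
have [l [lP lim_l]] := mean_ergodic start transition_pow_bounded.
have lE i : lambda R B (fmat i) = l 0 i.
  apply: cesaro_fast_lim; apply: eq_cesaro_fast (lim_l i) => m m0.
  by rewrite mu_powE.
have -> : lambda_row = l by apply/rowP => i; rewrite mxE lE.
by split=> // i; rewrite lE.
Qed.

Lemma lambda_ge0 i : 0 <= lambda R B (fmat i).
Proof.
apply: cesaro_fast_ge0 (lambda_cesaro.2 i) => m _.
rewrite mxE sumr_ge0 // => j _.
by rewrite mulr_ge0 ?transition_pow_ge0 // mxE ler0n.
Qed.

Lemma lambda_invariant (g : 'M[rat]_n -> rat) :
  \sum_i lambda R B (fmat i) * g (fmat i) =
  \sum_i lambda R B (fmat i) *
    (2^-1 * g (R *m fmat i) + 2^-1 * g (B *m fmat i)).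
Proof.
transitivity (\sum_i (lambda_row *m P) 0 i * g (fmat i)).
  by rewrite lambda_cesaro.1; apply: eq_bigr => i _; rewrite mxE.
by rewrite row_transition_sum; apply: eq_bigr => i _; rewrite mxE.
Qed.

Lemma lambda_out w : ~ semigroup R B w -> lambda R B w = 0.
Proof.
move=> nw; apply: cesaro_fast_lim; exists 0 => M.
by rewrite mulr0 subr0 big1 ?normr0 // => m _; apply: mu_pow_out.
Qed.

(** Invariance bounds the mass of [s *m fmat i] below by half that of [fmat i]. *)
Lemma lambda_step s i : s = R \/ s = B -> lambda R B (fmat i) <> 0 ->
  lambda R B (s *m fmat i) <> 0.
Proof.
move=> sRB li; have fs : is_funmx s by case: sRB => ->.
have fsi : is_funmx (s *m fmat i) by apply: is_funmx_mul => //; exists i.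
have := lambda_invariant (fun w => (s *m fmat i == w)%:R).
under eq_bigr do rewrite mulrC.
rewrite (sum_fmat_eq _ fsi) => -> /eqP; rewrite psumr_eq0 => [|j _]; last first.
  by rewrite mulr_ge0 ?lambda_ge0 // addr_ge0 // mulr_ge0 // ler0n.
move=> /allP/(_ i); rewrite mem_index_enum => /(_ isT) /=.
rewrite mulf_eq0 => /orP[/eqP//|].
rewrite paddr_eq0 ?mulr_ge0 ?ler0n // !mulf_eq0 invr_eq0 !pnatr_eq0 /= !eqb0.
by case: sRB => ->; rewrite eqxx ?andbF.
Qed.

(** Apply invariance to the indicator [g] of the complement of [K].  Absorption
    makes [g] nonincreasing along each step, so equality of the two averages
    forces [g] to be constant along the steps from every charged state. *)
Lemma lambda_step_out K s i : two_sided_ideal (semigroup R B) K ->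
  s = R \/ s = B -> lambda R B (fmat i) <> 0 ->
  ~ K (fmat i) -> ~ K (s *m fmat i).
Proof.
case=> _ _ K_abs sRB /eqP li nKi.
pose g (w : 'M[rat]_n) : rat := (~~ `[< K w >])%:R.
have g_le t w : semigroup R B t -> g (t *m w) <= g w.
  move=> St; rewrite ler_nat; case: asboolP => [|nKtw] //=; case: asboolP => // Kw.
  by case: nKtw; case: (K_abs t w St Kw).
have g_le_R j := g_le R (fmat j) (semigroup_R R B).
have g_le_B j := g_le B (fmat j) (semigroup_B R B).
have /eqP := lambda_invariant g; rewrite -subr_eq0 -sumrB psumr_eq0; last first.
  move=> j _; rewrite -mulrBr mulr_ge0 ?lambda_ge0 //.
  by have := g_le_R j; have := g_le_B j; lra.
move=> /allP/(_ i); rewrite mem_index_enum => /(_ isT) /=.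
rewrite -mulrBr mulf_eq0 (negPf li) /= => /eqP g_eq.
have gi : g (fmat i) = 1 by rewrite /g; case: asboolP.
have gs : g (s *m fmat i) = 1.
  by have := g_le_R i; have := g_le_B i; case: sRB => ->; lra.
move=> Ks; move: gs; rewrite /g asboolT // => /eqP; rewrite eq_sym oner_eq0 //.
Qed.

(** A charged state [w] outside [K] would keep all its left multiples outside
    [K], but [k *m w] is in [K] for any [k] in [K]. *)
Lemma lambda_support K w : two_sided_ideal (semigroup R B) K ->
  is_funmx w -> ~ K w -> lambda R B w = 0.
Proof.
move=> K_ideal fw nKw; apply: contrapT => lw.
pose bad x := [/\ is_funmx x, lambda R B x <> 0 & ~ K x].
have bad_step s x : s = R \/ s = B -> bad x -> bad (s *m x).
  move=> sRB [[i ->] li nKi]; split.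
  - by apply: is_funmx_mul; [case: sRB => -> | exists i].
  - exact: lambda_step.
  - exact: lambda_step_out.
have bad_mul s x : semigroup R B s -> bad x -> bad (s *m x).
  move=> Ss; elim: Ss x => {s} [||s t _ IHs _ IHt] x bx.
  - by apply: bad_step => //; left.
  - by apply: bad_step => //; right.
  - by rewrite -mulmxA; apply/IHs/IHt.
have [[k Kk] KS K_abs] := K_ideal.
have [_ _ []] := bad_mul k w (KS k Kk) (And3 fw lw nKw).
have Sw : semigroup R B w by apply: contrapT => /lambda_out.
by case: (K_abs w k Sw Kk).
Qed.

Lemma kernel_averageE K f : two_sided_ideal (semigroup R B) K ->
  kernel_average R B K f = \sum_i lambda R B (fmat i) *: f (fmat i).
Proof.
move=> K_ideal; have [_ KS _] := K_ideal.
rewrite /kernel_average fsbig_funmx; last first.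
  by move=> w /KS; apply: semigroup_is_funmx.
rewrite big_mkcond; apply: eq_bigr => i _; case: asboolP => // nKi.
by rewrite (lambda_support K_ideal) ?scale0r //; exists i.
Qed.

(** * Omega2 as an average under the invariant measure *)

(** One step of the chain multiplies [vee2] on the left by [A2] on average,
    because [vee2] is multiplicative. *)
Lemma A2_powE m p q :
  (A2 R B ^+ m) p q = \sum_i (start *m P ^+ m) 0 i * vee2 (fmat i) p q.
Proof.
elim: m p q => [|m IHm] p q.
  by rewrite !expr0 mulmx1 (sum_start (fun w => vee2 w p q)) vee2_1.
have -> : start *m P ^+ m.+1 = start *m P ^+ m *m P by rewrite exprSr mulmxA.
rewrite (row_transition_sum _ (fun w => vee2 w p q)).
rewrite exprS mxE; under eq_bigr do rewrite IHm mulr_sumr.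
rewrite exchange_big; apply: eq_bigr => i _ /=.
under eq_bigr do rewrite mulrCA; rewrite -mulr_sumr; congr (_ * _).
rewrite -!vee2_mul -mulrDr.
have -> : \sum_s A2 R B p s * vee2 (fmat i) s q = (A2 R B *m vee2 (fmat i)) p q.
  by rewrite mxE.
by rewrite /A2 -scalemxAl mulmxDl mxE [in LHS]mxE.
Qed.

Lemma Omega2E p q :
  Omega2 R B p q = \sum_i lambda R B (fmat i) * vee2 (fmat i) p q.
Proof.
rewrite mxE; apply: cesaro_fast_lim.
rewrite (_ : (fun _ => _) =
             fun m => \sum_i (start *m P ^+ m) 0 i * vee2 (fmat i) p q).
  exact: cesaro_fast_sum lambda_cesaro.2.
by apply/funext => m; rewrite A2_powE.
Qed.

Lemma u2E K p : two_sided_ideal (semigroup R B) K ->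
  u2 R B 0 p = N0 R B K (lo p) (hi p).
Proof.
move=> K_ideal; rewrite /N0 kernel_averageE // mxE mxE summxE.
under eq_bigr do rewrite Omega2E mxE mxE mulr1.
rewrite exchange_big; apply: eq_bigr => i _ /=.
by rewrite -mulr_sumr vee2_row_sum [RHS]mxE.
Qed.

Lemma pi2E K p : two_sided_ideal (semigroup R B) K ->
  pi2 R B 0 p = Mavg R B K (lo p) (hi p).
Proof.
move=> K_ideal; rewrite /Mavg kernel_averageE // mxE summxE.
under eq_bigr do rewrite Omega2E mxE mul1r.
rewrite exchange_big; apply: eq_bigr => i _ /=.
by rewrite -mulr_sumr vee2_col_sum [RHS]mxE.
Qed.

Lemma N0_sym K i j : two_sided_ideal (semigroup R B) K ->
  N0 R B K i j = N0 R B K j i.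
Proof.
move=> K_ideal; rewrite /N0 kernel_averageE // !summxE; apply: eq_bigr => k _.
rewrite !mxE; congr (_ * (_ - _)); apply: eq_bigr => l _.
by rewrite ![_^T _ _]mxE mulrC.
Qed.

Lemma Mavg_sym K i j : two_sided_ideal (semigroup R B) K ->
  Mavg R B K i j = Mavg R B K j i.
Proof.
move=> K_ideal; rewrite /Mavg kernel_averageE // !summxE; apply: eq_bigr => k _.
rewrite [LHS]mxE [RHS]mxE -[in LHS](trmxK (_ *m _)) [in LHS]mxE.
by rewrite !trmx_mul trmxK trmx_const mulmxA.
Qed.
End Chain.

Theorem proposition9p9 (n : nat) (G : 'M[nat]_n) (A R B : 'M[rat]_n)
    (K : set 'M[rat]_n) (X : 'rV[rat]_(npairs n))
    (G_out : out_regular 2 G) (G_conn : strongly_connected G)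
    (G_aper : aperiodic G)
    (A_adj : 2%:R *: A = \matrix_(i, j) (G i j)%:R)
    (R_bs : binary_stochastic R) (B_bs : binary_stochastic B)
    (A_eq : A = 2%:R^-1 *: (R + B))
    (K_ker : is_kernel (semigroup R B) K) :
  [/\ (X *m Omega2 R B *m (ones2 n)^T) 0 0 = (X *m (u2 R B)^T) 0 0,
      (X *m (u2 R B)^T) 0 0 = inner2 X (u2 R B),
      inner2 X (u2 R B) = 2%:R^-1 * \tr (Mat X *m Mat (u2 R B)) &
      2%:R^-1 * \tr (Mat X *m Mat (u2 R B))
        = 2%:R^-1 * \tr (Mat X *m N0 R B K)] /\
  [/\ (ones2 n *m Omega2 R B *m X^T) 0 0 = (pi2 R B *m X^T) 0 0,
      (pi2 R B *m X^T) 0 0 = inner2 (pi2 R B) X,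
      inner2 (pi2 R B) X = 2%:R^-1 * \tr (Mat (pi2 R B) *m Mat X) &
      2%:R^-1 * \tr (Mat (pi2 R B) *m Mat X)
        = 2%:R^-1 * \tr (Mat X *m Mavg R B K)].
Proof.
have [R_funmx B_funmx] := (is_funmx_bs R_bs, is_funmx_bs B_bs).
have K_ideal := K_ker.1.
split; split=> //; rewrite ?inner2E //.
- by rewrite /u2 trmxK mulmxA.
- have N0_symK i j := N0_sym R_funmx B_funmx i j K_ideal.
  rewrite !trace_Mat //; last exact: Mat_sym.
  by apply: eq_bigr => p _; rewrite Mat_lo_hi (u2E R_funmx B_funmx p K_ideal).
- rewrite mxtrace_mulC.
  have Mavg_symK i j := Mavg_sym R_funmx B_funmx i j K_ideal.
  rewrite !trace_Mat //; last exact: Mat_sym.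
  by apply: eq_bigr => p _; rewrite Mat_lo_hi (pi2E R_funmx B_funmx p K_ideal).
Qed.
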